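(* Let $\alpha\in(0,1)$, $L>0$ and $U\ge 1$. For any $x_{1:U}\in\mathbb R^U$ and any left and right uncertainties $\Delta_{1:U} = (\Delta_{u,left},\Delta_{u,right})_{u\in[U]} \in \mathbb R_{\ge 0}^{2U}$, the map $w_{1:U}\mapsto \mathrm{QrQtl}_{\alpha,L}(w_{1:U},x_{1:U},\Delta_{1:U})$ from $\mathbb R_{\ge 0}^U$ to $\mathbb R$ is $L$-Lipschitz continuous with respect to the norm $\|\cdot\|_1$ on the domain and $|\cdot|$ on $\mathbb R$, i.e. $$\left|\mathrm{QrQtl}_{\alpha,L}(w,x,\Delta)-\mathrm{QrQtl}_{\alpha,L}(w',x,\Delta)\right|\le L\,\|w-w'\|_1 \quad\text{for all } w,w'\in\mathbb R_{\ge0}^U.$$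
   Context: For $x\in\mathbb R$ and $\Delta=(\Delta_{left},\Delta_{right})\in\mathbb R_{\ge0}^2$, the asymmetric Huber loss is $$\mathrm{Huber}_\alpha(m|x,\Delta)=\begin{cases}\min\{1,\tfrac{1-\alpha}{\alpha}\}\left(\sqrt{\Delta_{left}^2+(x-m)^2}-\Delta_{left}\right) & \text{for } m\le x,\\ \min\{1,\tfrac{\alpha}{1-\alpha}\}\left(\sqrt{\Delta_{right}^2+(m-x)^2}-\Delta_{right}\right) & \text{for } m\ge x.\end{cases}$$ For $w\in\mathbb R_{\ge0}^U$ (voting rights), $x\in\mathbb R^U$ (scores) and $\Delta\in\mathbb R_{\ge0}^{2U}$ (uncertainties), the quadratically regularized quantile is $$\mathrm{QrQtl}_{\alpha,L}(w,x,\Delta)=\operatorname*{argmin}_{m\in\mathbb R}\left\{\frac{m^2}{2L}+\sum_{u\in[U]} w_u\,\mathrm{Huber}_\alpha(m|x_u,\Delta_u)\right\},$$ the unique minimizer of this strongly convex function. *)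

(* Defs.v *)
From mathcomp Require Import all_boot all_order all_algebra.
From mathcomp Require Import all_classical all_reals all_analysis.
From mathcomp Require Import ring lra.
Import Order.TTheory GRing.Theory Num.Theory.
Import numFieldNormedType.Exports.

Set Implicit Arguments.
Unset Strict Implicit.
Unset Printing Implicit Defensive.

Local Open Scope classical_set_scope.
Local Open Scope ring_scope.

(* Delta = (Delta_left, Delta_right).  For nonnegative Delta both branches
   vanish at m = x, so it does not matter which one is used there. *)
Definition Huber (R : realType) (alpha m x : R) (Delta : R * R) : R :=
  if m <= x
  then Num.min 1 ((1 - alpha) / alpha) *
         (Num.sqrt (Delta.1 ^+ 2 + (x - m) ^+ 2) - Delta.1)
  else Num.min 1 (alpha / (1 - alpha)) *
         (Num.sqrt (Delta.2 ^+ 2 + (m - x) ^+ 2) - Delta.2).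

Definition QrQtl_objective (R : realType) (U : nat) (alpha L : R)
    (w x : 'rV[R]_U) (Delta : 'I_U -> R * R) (m : R) : R :=
  m ^+ 2 / (2 * L) + \sum_(u < U) w 0 u * Huber alpha m (x 0 u) (Delta u).

Definition argmin (R : realType) (f : R -> R) : set R :=
  [set m | forall m', f m <= f m'].

(* The default value 0 of xget is irrelevant for admissible parameters: the
   set of minimizers is then a singleton (argmin_QrQtl_unique). *)
Definition QrQtl (R : realType) (U : nat) (alpha L : R)
    (w x : 'rV[R]_U) (Delta : 'I_U -> R * R) : R :=
  xget 0 (argmin (QrQtl_objective alpha L w x Delta)).

(* The normed-module structure of 'rV[R]_U carries the sup norm, hence this
   separate definition. *)
Definition l1norm (R : realType) (U : nat) (v : 'rV[R]_U) : R :=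
  \sum_(u < U) `|v 0 u|.

Section WellDefined.
Variable R : realType.
Implicit Types (D s t x m : R).

Let phi D t : R := Num.sqrt (D ^+ 2 + (Num.max 0 t) ^+ 2) - D.

Let phi0 D t : 0 <= D -> t <= 0 -> phi D t = 0.
Proof.
by move=> D0 t0; rewrite /phi max_l// expr0n/= addr0 sqrtr_sqr ger0_norm// subrr.
Qed.

Let phi_ge0 D t : 0 <= D -> 0 <= phi D t.
Proof.
move=> D0; rewrite subr_ge0 -[leLHS]ger0_norm// -sqrtr_sqr.
by apply: ler_wsqrtr; rewrite lerDl sqr_ge0.
Qed.

Let sqrt_mid D (a b c : R) : 0 <= D -> 0 <= a -> 0 <= b -> 0 <= c ->
  c <= (a + b) / 2 ->
  Num.sqrt (D ^+ 2 + c ^+ 2) <=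
    (Num.sqrt (D ^+ 2 + a ^+ 2) + Num.sqrt (D ^+ 2 + b ^+ 2)) / 2.
Proof.
move=> D0 a0 b0 c0 h.
have : 0 <= Num.sqrt (D ^+ 2 + a ^+ 2) := sqrtr_ge0 _.
have : 0 <= Num.sqrt (D ^+ 2 + b ^+ 2) := sqrtr_ge0 _.
have : Num.sqrt (D ^+ 2 + a ^+ 2) ^+ 2 = D ^+ 2 + a ^+ 2.
  by rewrite sqr_sqrtr// addr_ge0// sqr_ge0.
have : Num.sqrt (D ^+ 2 + b ^+ 2) ^+ 2 = D ^+ 2 + b ^+ 2.
  by rewrite sqr_sqrtr// addr_ge0// sqr_ge0.
move: (Num.sqrt (D ^+ 2 + a ^+ 2) : R) (Num.sqrt (D ^+ 2 + b ^+ 2) : R).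
move=> p q qE pE q0 p0.
have pq : D ^+ 2 + a * b <= p * q.
  rewrite -(@ler_pXn2r _ 2)// ?nnegrE ?mulr_ge0// ?addr_ge0 ?sqr_ge0 ?mulr_ge0//.
  rewrite exprMn pE qE -subr_ge0.
  by rewrite (_ : _ - _ = (D * (a - b)) ^+ 2) ?sqr_ge0//; ring.
rewrite -[leRHS]ger0_norm ?divr_ge0 ?addr_ge0// -sqrtr_sqr.
apply: ler_wsqrtr.
have : c ^+ 2 <= ((a + b) / 2) ^+ 2.
  by rewrite ler_pXn2r// nnegrE divr_ge0 ?addr_ge0.
have -> : ((a + b) / 2) ^+ 2 = (a ^+ 2 + b ^+ 2 + 2 * (a * b)) / 4 by field.
have -> : ((p + q) / 2) ^+ 2 = (p ^+ 2 + q ^+ 2 + 2 * (p * q)) / 4 by field.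
by rewrite pE qE; lra.
Qed.

Let phi_mid D s t : 0 <= D -> phi D ((s + t) / 2) <= (phi D s + phi D t) / 2.
Proof.
move=> D0; rewrite /phi.
have s0 : 0 <= Num.max 0 s by rewrite le_max lexx.
have t0 : 0 <= Num.max 0 t by rewrite le_max lexx.
have h0 : 0 <= Num.max 0 ((s + t) / 2) by rewrite le_max lexx.
have h : Num.max 0 ((s + t) / 2) <= (Num.max 0 s + Num.max 0 t) / 2.
  have hs : s <= Num.max 0 s by rewrite le_max lexx orbT.
  have ht : t <= Num.max 0 t by rewrite le_max lexx orbT.
  rewrite ge_max; apply/andP; split; first by rewrite divr_ge0 ?addr_ge0.
  by rewrite ler_pM2r ?invr_gt0// lerD.
have aux (A P Q : R) :
  A <= (P + Q) / 2 -> A - D <= (P - D + (Q - D)) / 2 by lra.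
exact: aux (sqrt_mid D0 s0 t0 h0 h).
Qed.

Let phi_cont D : continuous (phi D).
Proof.
move=> t; apply: cvgB; last exact: cvg_cst.
apply: (@continuous_comp _ _ _ (fun t => D ^+ 2 + Num.max 0 t ^+ 2) Num.sqrt);
  last exact: sqrt_continuous.
apply: cvgD; first exact: cvg_cst.
apply: (@continuous_comp _ _ _ (fun t => Num.max 0 t) (fun t => t ^+ 2));
  last exact: exprn_continuous.
by apply: continuous_max; [exact: cvg_cst|exact: cvg_id].
Qed.

Variables (alpha : R) (alpha01 : 0 < alpha < 1).

Let cl := Num.min 1 ((1 - alpha) / alpha).
Let cr := Num.min 1 (alpha / (1 - alpha)).

Let cl0 : 0 <= cl.
Proof.
have /andP[a0 a1] := alpha01.
by rewrite le_min ler01 divr_ge0 ?subr_ge0// ltW.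
Qed.

Let cr0 : 0 <= cr.
Proof.
have /andP[a0 a1] := alpha01.
by rewrite le_min ler01 divr_ge0 ?subr_ge0// ltW.
Qed.

Let HuberE m x (Delta : R * R) : 0 <= Delta.1 -> 0 <= Delta.2 ->
  Huber alpha m x Delta = cl * phi Delta.1 (x - m) + cr * phi Delta.2 (m - x).
Proof.
move=> D1 D2; rewrite /Huber -/cl -/cr; case: (leP m x) => mx.
  rewrite (phi0 (t := m - x))// ?subr_le0// mulr0 addr0.
  by rewrite /phi max_r// subr_ge0.
rewrite (phi0 (t := x - m))// ?subr_le0 1?ltW// mulr0 add0r.
by rewrite /phi max_r// subr_ge0 ltW.
Qed.

Lemma argmin_QrQtl_unique (U : nat) (L : R) (w x : 'rV[R]_U)
    (Delta : 'I_U -> R * R) :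
  0 < L -> (forall u, 0 <= w 0 u) ->
  (forall u, 0 <= (Delta u).1 /\ 0 <= (Delta u).2) ->
  exists! m, argmin (QrQtl_objective alpha L w x Delta) m.
Proof.
move=> L0 w0 D0; set f := QrQtl_objective _ _ _ _ _.
pose g m := \sum_(u < U) w 0 u * (cl * phi (Delta u).1 (x 0 u - m) +
                                  cr * phi (Delta u).2 (m - x 0 u)).
have fE m : f m = m ^+ 2 / (2 * L) + g m.
  rewrite /f /QrQtl_objective; congr (_ + _); apply: eq_bigr => u _.
  by have [? ?] := D0 u; rewrite HuberE.
have g_ge0 m : 0 <= g m.
  apply: sumr_ge0 => u _; have [D1 D2] := D0 u.
  by rewrite mulr_ge0// addr_ge0// mulr_ge0// phi_ge0.
have g_mid a b : g ((a + b) / 2) <= (g a + g b) / 2.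
  rewrite /g -big_split/= mulr_suml; apply: ler_sum => u _.
  have [D1 D2] := D0 u.
  rewrite -mulrDr -mulrA; apply: ler_wpM2l => //.
  have -> : x 0 u - (a + b) / 2 = ((x 0 u - a) + (x 0 u - b)) / 2 by field.
  have -> : (a + b) / 2 - x 0 u = ((a - x 0 u) + (b - x 0 u)) / 2 by field.
  have := ler_wpM2l cl0 (phi_mid (x 0 u - a) (x 0 u - b) D1).
  have := ler_wpM2l cr0 (phi_mid (a - x 0 u) (b - x 0 u) D2).
  by lra.
have g_cont : continuous g.
  rewrite /g; elim: (index_enum _) => [|u r ih] m.
    under eq_fun do rewrite big_nil.
    exact: cvg_cst.
  under eq_fun do rewrite big_cons.
  apply: cvgD; last exact: ih.
  apply: cvgM; first exact: cvg_cst.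
  apply: cvgD; (apply: cvgM; first exact: cvg_cst).
    apply: (@continuous_comp _ _ _ (fun m => x 0 u - m)); last exact: phi_cont.
    by apply: cvgB; [exact: cvg_cst|exact: cvg_id].
  apply: (@continuous_comp _ _ _ (fun m => m - x 0 u)); last exact: phi_cont.
  by apply: cvgB; [exact: cvg_id|exact: cvg_cst].
have f_cont : continuous f.
  rewrite (_ : f = fun m => m ^+ 2 / (2 * L) + g m); last exact/funext.
  move=> m; apply: cvgD; last exact: g_cont.
  by apply: cvgM; [exact: exprn_continuous|exact: cvg_cst].
have f0 : 0 <= f 0 by rewrite fE expr0n/= mul0r add0r.
pose M := 2 * L * f 0 + 1.
have M1 : 1 <= M by rewrite /M lerDr !mulr_ge0// ltW.
have NMM : - M <= M by lra.
have [c _ cmin] := EVT_min NMM (continuous_subspaceT f_cont).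
have fc m : f c <= f m.
  have [mM|mM] := boolP (m \in `[- M, M]); first exact: cmin.
  apply: (@le_trans _ _ (f 0)); first by apply: cmin; rewrite in_itv/=; lra.
  have Mm : M <= `|m|.
    by move: mM; rewrite in_itv/= -ler_norml -ltNge => /ltW.
  have m1 : 1 <= `|m| := le_trans M1 Mm.
  have m2 : M <= m ^+ 2.
    rewrite -real_normK ?num_real// expr2 (le_trans Mm)//.
    by rewrite ler_peMl// (le_trans ler01).
  rewrite [f m]fE -[leLHS]addr0; apply: lerD => //.
  by rewrite ler_pdivlMr ?mulr_gt0// (le_trans _ m2)// /M; lra.
exists c; split=> // c' c'min; apply/eqP/negPn/negP => cc'.
have := c'min ((c + c') / 2); have := c'min c; have := fc c'.
have := g_mid c c'; rewrite !fE.
have : 0 < (c - c') ^+ 2 / (2 * L).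
  apply: divr_gt0; last by rewrite mulr_gt0.
  by rewrite exprn_even_gt0//= subr_eq0.
have -> : ((c + c') / 2) ^+ 2 / (2 * L) =
    (c ^+ 2 / (2 * L) + c' ^+ 2 / (2 * L)) / 2 - (c - c') ^+ 2 / (2 * L) / 4.
  by field; rewrite gt_eqF.
lra.
Qed.

End WellDefined.

(* Main.v *)
(** The objective is the sum of the quadratic [m^2/(2L)] and a convex function, so it exceeds
    its minimum by at least [(m - c)^2/(2L)], where [c] is the minimizer. Adding this bound for
    the weights [w], at the minimizer [c'] for [w'], to the one with both roles exchanged gives
    [(c - c')^2 / L <= \sum_u (w_u - w'_u) (H_u c' - H_u c)], where the quadratic terms
    have cancelled. Each Huber loss [H_u] is 1-Lipschitz, so the right-hand side is at most
    [l1norm (w - w') * |c - c'|]. *)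
Require Import Defs.
From mathcomp Require Import all_boot all_order all_algebra.
From mathcomp Require Import all_classical all_reals all_analysis.
From mathcomp Require Import ring lra.
Import Order.TTheory GRing.Theory Num.Theory.
Local Open Scope ring_scope.

Definition is_convex {R : realType} (g : R -> R) : Prop :=
  forall t a b, 0 <= t <= 1 -> g ((1 - t) * a + t * b) <= (1 - t) * g a + t * g b.

(** This is the limit [t -> 0] done by hand: if [e < K], a single small [t] already contradicts the
    bound. *)
Lemma ler_of_shrink (R : realFieldType) (K e : R) :
  0 <= e -> (forall t, 0 < t -> t <= 1 -> (1 - t) * K <= e) -> K <= e.
Proof.
move=> e0 H; rewrite leNgt; apply/negP => eK.
have K0 : 0 < K := le_lt_trans e0 eK.
(* This [t] makes [(1 - t) * K] the midpoint of [K] and [e], which exceeds [e]. *)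
have t0 : 0 < (K - e) / (2 * K).
  by apply: divr_gt0; [rewrite subr_gt0|rewrite mulr_gt0].
have t1 : (K - e) / (2 * K) <= 1.
  by rewrite ler_pdivrMr ?mulr_gt0// mul1r; lra.
have := H _ t0 t1.
have -> : (1 - (K - e) / (2 * K)) * K = (K + e) / 2.
  by field; rewrite gt_eqF.
by lra.
Qed.

(** Compare [c] with the point [(1 - t) * c + t * m], divide by [t], then let [t] tend to 0. *)
Lemma argmin_quadratic_growth (R : realType) (L : R) (g : R -> R) (c m : R) :
  0 < L -> is_convex g -> argmin (fun m => m ^+ 2 / (2 * L) + g m) c ->
  c ^+ 2 / (2 * L) + g c + (m - c) ^+ 2 / (2 * L) <= m ^+ 2 / (2 * L) + g m.
Proof.
move=> L0 gconv cmin.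
set K := (m - c) ^+ 2 / (2 * L).
set fc := _ + g c; set fm := _ + g m.
have e0 : 0 <= fm - fc by rewrite subr_ge0; exact: cmin.
have H t : 0 < t -> t <= 1 -> (1 - t) * K <= fm - fc.
  move=> t0 t1.
  have := cmin ((1 - t) * c + t * m); rewrite -/fc => h1.
  have h2 : g ((1 - t) * c + t * m) <= (1 - t) * g c + t * g m.
    by apply: gconv; rewrite ltW.
  rewrite -(ler_pM2l t0) -subr_ge0.
  (* The last term is the strong convexity gain of the square. *)
  have E : ((1 - t) * c + t * m) ^+ 2 / (2 * L) =
      (1 - t) * (c ^+ 2 / (2 * L)) + t * (m ^+ 2 / (2 * L)) - t * ((1 - t) * K).
    by rewrite /K; field; rewrite gt_eqF.
  by move: h1 h2; rewrite E /fc /fm; lra.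
by have := ler_of_shrink _ _ _ e0 H; lra.
Qed.

(** The positive part extends one branch of [Huber] by a constant beyond its kink, so that the loss
    becomes a sum without case distinction. *)
Definition hinge_hypot {R : realType} (D t : R) : R :=
  Num.sqrt (D ^+ 2 + Num.max 0 t ^+ 2).

Lemma hinge_hypot_convex (R : realType) (D : R) : is_convex (hinge_hypot D).
Proof.
move=> t x y /andP[t0 t1]; rewrite /hinge_hypot.
have s0 : 0 <= 1 - t by rewrite subr_ge0.
set z := _ + t * y.
have : 0 <= Num.max 0 z by rewrite le_max lexx.
have : Num.max 0 z <= (1 - t) * Num.max 0 x + t * Num.max 0 y.
  by rewrite ge_max addr_ge0 ?lerD ?ler_wpM2l ?mulr_ge0 ?le_max ?lexx ?orbT.
have : 0 <= Num.max 0 x by rewrite le_max lexx.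
have : 0 <= Num.max 0 y by rewrite le_max lexx.
move: (Num.max 0 x) (Num.max 0 y) (Num.max 0 z) => a b c b0 a0 cab c0.
have : 0 <= Num.sqrt (D ^+ 2 + a ^+ 2) := sqrtr_ge0 _.
have : 0 <= Num.sqrt (D ^+ 2 + b ^+ 2) := sqrtr_ge0 _.
have : Num.sqrt (D ^+ 2 + a ^+ 2) ^+ 2 = D ^+ 2 + a ^+ 2.
  by rewrite sqr_sqrtr// addr_ge0// sqr_ge0.
have : Num.sqrt (D ^+ 2 + b ^+ 2) ^+ 2 = D ^+ 2 + b ^+ 2.
  by rewrite sqr_sqrtr// addr_ge0// sqr_ge0.
move: (Num.sqrt (D ^+ 2 + a ^+ 2)) (Num.sqrt (D ^+ 2 + b ^+ 2)).
move=> p q qE pE q0 p0.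
(* Cauchy-Schwarz for the vectors [(D, a)] and [(D, b)]. *)
have pq : D ^+ 2 + a * b <= p * q.
  rewrite -(@ler_pXn2r _ 2)// ?nnegrE ?mulr_ge0// ?addr_ge0 ?sqr_ge0 ?mulr_ge0//.
  rewrite exprMn pE qE -subr_ge0.
  by rewrite (_ : _ - _ = (D * (a - b)) ^+ 2) ?sqr_ge0//; ring.
rewrite -[leRHS]ger0_norm ?addr_ge0 ?mulr_ge0// -sqrtr_sqr.
apply: ler_wsqrtr.
have : c ^+ 2 <= ((1 - t) * a + t * b) ^+ 2.
  by rewrite ler_pXn2r// nnegrE addr_ge0 ?mulr_ge0.
(* The weight [t * (1 - t)] is that of the cross term in the expanded square below. *)
have := ler_wpM2l (mulr_ge0 t0 s0) pq.
have -> : ((1 - t) * p + t * q) ^+ 2 =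
  (1 - t) ^+ 2 * p ^+ 2 + t ^+ 2 * q ^+ 2 + 2 * (t * (1 - t) * (p * q)) by ring.
by rewrite pE qE; lra.
Qed.

(** Both the positive part and the hypotenuse as a function of a nonnegative leg are nondecreasing
    and 1-Lipschitz. The sign is kept for combining the two sides of [Huber]. *)
Lemma hinge_hypot_increment (R : realType) (D s t : R) : s <= t ->
  0 <= hinge_hypot D t - hinge_hypot D s <= t - s.
Proof.
move=> st; rewrite /hinge_hypot.
have : Num.max 0 t - Num.max 0 s <= t - s.
  by case: (leP 0 t) => ht; case: (leP 0 s) => hs; lra.
have : Num.max 0 s <= Num.max 0 t.
  by case: (leP 0 t) => ht; case: (leP 0 s) => hs; lra.
have : 0 <= Num.max 0 s by rewrite le_max lexx.
move: (Num.max 0 s) (Num.max 0 t) => a b a0 ab bats.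
have b0 := le_trans a0 ab.
apply/andP; split.
  by rewrite subr_ge0; apply: ler_wsqrtr; rewrite lerD2l ler_pXn2r// nnegrE.
apply: le_trans bats; rewrite lerBlDl.
have pE : Num.sqrt (D ^+ 2 + a ^+ 2) ^+ 2 = D ^+ 2 + a ^+ 2.
  by rewrite sqr_sqrtr// addr_ge0// sqr_ge0.
have ap : a <= Num.sqrt (D ^+ 2 + a ^+ 2).
  by rewrite -[leLHS]ger0_norm// -sqrtr_sqr ler_wsqrtr// lerDr sqr_ge0.
rewrite -[leRHS]ger0_norm; last by rewrite addr_ge0 ?sqrtr_ge0 ?subr_ge0.
rewrite -sqrtr_sqr; apply: ler_wsqrtr.
move: (Num.sqrt _) pE ap => p pE ap.
(* Twice this product is exactly the difference of the two radicands. *)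
have := mulr_ge0 (_ : 0 <= p - a) (_ : 0 <= b - a); rewrite !subr_ge0 => /(_ ap ab).
have -> : (p + (b - a)) ^+ 2 = p ^+ 2 + 2 * (p * (b - a)) + (b - a) ^+ 2 by ring.
by rewrite pE; lra.
Qed.

Section Huber.
Variables (R : realType) (alpha x : R) (D : R * R).
Hypotheses (alpha01 : 0 < alpha < 1) (D1 : 0 <= D.1) (D2 : 0 <= D.2).

Let cl := Num.min 1 ((1 - alpha) / alpha).
Let cr := Num.min 1 (alpha / (1 - alpha)).

(** The lower bound serves convexity; the upper one, due to the cap at 1, gives the Lipschitz
    constant 1. *)
Let cl01 : 0 <= cl <= 1.
Proof.
have /andP[a0 a1] := alpha01.
by rewrite le_min ler01 ge_min lexx !andbT divr_ge0 ?subr_ge0 ?ltW.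
Qed.

Let cr01 : 0 <= cr <= 1.
Proof.
have /andP[a0 a1] := alpha01.
by rewrite le_min ler01 ge_min lexx !andbT divr_ge0 ?subr_ge0 ?ltW.
Qed.

(** On each side of [x] one positive part is 0, and its summand vanishes because
    [Num.sqrt (d ^+ 2) = d] for [0 <= d]. *)
Lemma Huber_hinge_hypot m : Huber alpha m x D =
  cl * (hinge_hypot D.1 (x - m) - D.1) + cr * (hinge_hypot D.2 (m - x) - D.2).
Proof.
have hinge0 (d t : R) : 0 <= d -> t <= 0 -> hinge_hypot d t - d = 0.
  move=> d0 t0.
  by rewrite /hinge_hypot max_l// expr0n/= addr0 sqrtr_sqr ger0_norm// subrr.
rewrite /Huber -/cl -/cr; case: (leP m x) => mx.
  rewrite (hinge0 _ (m - x))// ?subr_le0// mulr0 addr0.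
  by rewrite /hinge_hypot max_r// subr_ge0.
rewrite (hinge0 _ (x - m))// ?subr_le0 1?ltW// mulr0 add0r.
by rewrite /hinge_hypot max_r// subr_ge0 ltW.
Qed.

Lemma Huber_convex : is_convex (fun m => Huber alpha m x D).
Proof.
move=> t a b t01; rewrite !Huber_hinge_hypot.
have -> : x - ((1 - t) * a + t * b) = (1 - t) * (x - a) + t * (x - b) by ring.
have -> : (1 - t) * a + t * b - x = (1 - t) * (a - x) + t * (b - x) by ring.
have /andP[cl0 _] := cl01; have /andP[cr0 _] := cr01.
have := ler_wpM2l cl0 (hinge_hypot_convex _ D.1 t (x - a) (x - b) t01).
have := ler_wpM2l cr0 (hinge_hypot_convex _ D.2 t (a - x) (b - x) t01).
by lra.
Qed.

Lemma Huber_lipschitz m m' :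
  `|Huber alpha m x D - Huber alpha m' x D| <= `|m - m'|.
Proof.
wlog mm' : m m' / m <= m'.
  move=> H; case: (leP m m') => [/H//|/ltW/H].
  by rewrite distrC [leRHS]distrC.
rewrite distrC [leRHS]distrC [leRHS]ger0_norm ?subr_ge0// !Huber_hinge_hypot.
have incr_l : x - m' <= x - m by lra.
have incr_r : m - x <= m' - x by lra.
have /andP[l0 l1] := hinge_hypot_increment _ D.1 _ _ incr_l.
have /andP[r0 r1] := hinge_hypot_increment _ D.2 _ _ incr_r.
have /andP[cl0 cl1] := cl01; have /andP[cr0 cr1] := cr01.
(* The two hinges vary in opposite directions, so their increments do not add up. *)
have := mulr_ge0 cl0 l0; have := mulr_ge0 cr0 r0.
have := ler_piMl l0 cl1; have := ler_piMl r0 cr1.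
by rewrite ler_norml => *; apply/andP; split; lra.
Qed.

End Huber.

Lemma QrQtl_argmin (R : realType) (alpha L : R) (U : nat) (w x : 'rV[R]_U)
    (Delta : 'I_U -> R * R) :
  0 < alpha < 1 -> 0 < L -> (forall u, 0 <= w 0 u) ->
  (forall u, 0 <= (Delta u).1 /\ 0 <= (Delta u).2) ->
  argmin (QrQtl_objective alpha L w x Delta) (QrQtl alpha L w x Delta).
Proof.
(* Existence of a minimizer rules out the default value of [xget]. *)
move=> a01 L0 w0 D0; apply: xgetPex.
by have [c [cmin _]] := argmin_QrQtl_unique a01 x L0 w0 D0; exists c.
Qed.

(** Nonnegative weights keep the sum of Huber losses convex, so the general growth bound applies. *)
Lemma QrQtl_quadratic_growth (R : realType) (alpha L : R) (U : nat) (w x : 'rV[R]_U)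
    (Delta : 'I_U -> R * R) (c m : R) :
  0 < alpha < 1 -> 0 < L -> (forall u, 0 <= w 0 u) ->
  (forall u, 0 <= (Delta u).1 /\ 0 <= (Delta u).2) ->
  argmin (QrQtl_objective alpha L w x Delta) c ->
  QrQtl_objective alpha L w x Delta c + (m - c) ^+ 2 / (2 * L) <=
    QrQtl_objective alpha L w x Delta m.
Proof.
move=> a01 L0 w0 D0 cmin.
apply: argmin_quadratic_growth cmin => // t a b t01.
rewrite !mulr_sumr -big_split/=; apply: ler_sum => u _.
have [D1 D2] := D0 u.
have := ler_wpM2l (w0 u) (Huber_convex R alpha (x 0 u) (Delta u) a01 D1 D2 t a b t01).
by lra.
Qed.

Theorem theorem7p1 (R : realType) (alpha L : R) (U : nat)
    (halpha : 0 < alpha < 1) (hL : 0 < L) (hU : (1 <= U)%N)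
    (x : 'rV[R]_U) (Delta : 'I_U -> R * R)
    (hDelta : forall u, 0 <= (Delta u).1 /\ 0 <= (Delta u).2)
    (w w' : 'rV[R]_U)
    (hw : forall u, 0 <= w 0 u) (hw' : forall u, 0 <= w' 0 u) :
  `|QrQtl alpha L w x Delta - QrQtl alpha L w' x Delta| <= L * l1norm (w - w').
Proof.
have := QrQtl_argmin R alpha L U w x Delta halpha hL hw hDelta.
have := QrQtl_argmin R alpha L U w' x Delta halpha hL hw' hDelta.
move: (QrQtl alpha L w x Delta) (QrQtl alpha L w' x Delta) => c c' c'min cmin.
have := QrQtl_quadratic_growth _ _ _ _ _ _ _ _ c' halpha hL hw hDelta cmin.
have := QrQtl_quadratic_growth _ _ _ _ _ _ _ _ c halpha hL hw' hDelta c'min.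
rewrite /QrQtl_objective.
set S1 := \sum_(u < U) w' 0 u * Huber alpha c' _ _.
set S2 := \sum_(u < U) w' 0 u * Huber alpha c _ _.
set S3 := \sum_(u < U) w 0 u * Huber alpha c _ _.
set S4 := \sum_(u < U) w 0 u * Huber alpha c' _ _.
move=> growth' growth.
have lipschitz : S2 - S1 + (S4 - S3) <= l1norm (w - w') * `|c - c'|.
  rewrite /S1 /S2 /S3 /S4 /l1norm -!sumrB -big_split mulr_suml /=.
  apply: ler_sum => u _; have [D1 D2] := hDelta u.
  rewrite [leLHS](_ : _ = (w - w') 0 u *
    (Huber alpha c' (x 0 u) (Delta u) - Huber alpha c (x 0 u) (Delta u)));
    last by rewrite !mxE; ring.
  rewrite (le_trans (ler_norm _))// normrM distrC.
  by rewrite ler_wpM2l ?normr_ge0// Huber_lipschitz.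
have dist2 : (c - c') ^+ 2 / L <= l1norm (w - w') * `|c - c'|.
  (* Each growth bound contributes one half of [1 / L]. *)
  have <- : (c - c') ^+ 2 / (2 * L) + (c' - c) ^+ 2 / (2 * L) = (c - c') ^+ 2 / L.
    by field; rewrite gt_eqF.
  by lra.
(* The case [c = c'] is set apart because a factor [|c - c'|] is cancelled afterwards. *)
have [->|cc'] := eqVneq c c'.
  by rewrite subrr normr0 mulr_ge0 ?(ltW hL)//; apply: sumr_ge0.
have d0 : 0 < `|c - c'| by rewrite normr_gt0 subr_eq0.
rewrite -(ler_pM2r d0) -expr2 real_normK ?num_real// -mulrA mulrC.
by move: dist2; rewrite ler_pdivrMr// mulrC [X in _ <= X]mulrC.
Qed.
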